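(* $L_{eq \cdot b}= L_{eq} \cdot b^{+} \in \mathrm{S}^{>} \setminus (\mathrm{S}^{=} \cup \mathrm{S}^{\neq})$.
   Context: $L_{eq}=\{w\in\{a,b\}^*\mid |w|_a=|w|_b\}$, where $|w|_\sigma$ is the number of occurrences of $\sigma$ in $w$. Let $\Gamma=\Sigma\cup\{¢,\$\}$, where ¢ and \$ are left and right end-markers. A PFA $\mathcal{P}=(S,\Sigma,\{\mathsf{A}_\sigma:\sigma\in\Gamma\},F)$ has states $S=\{s_1,\dots,s_n\}$ (start state $s_1$), real stochastic $n\times n$ transition matrices $\mathsf{A}_\sigma$, and accepting states $F$; its acceptance probability on $w$ is $f_{\mathcal{P}}(w)=\sum_{s_i\in F}\mathsf{v}(i)$, $\mathsf{v}=(1,0,\dots,0)\mathsf{A}_{¢}\mathsf{A}_{w_1}\cdots\mathsf{A}_{w_{|w|}}\mathsf{A}_{\$}$. $\mathrm{S}^{>}$ is the class of languages $\{w:f_{\mathcal{P}}(w)>\lambda\}$, $\lambda\in[0,1)$; $\mathrm{S}^{=}$ the class $\{w:f_{\mathcal{P}}(w)=\lambda\}$, $\lambda\in[0,1]$; $\mathrm{S}^{\neq}$ the class $\{w:f_{\mathcal{P}}(w)\neq\lambda\}$, $\lambda\in[0,1]$, over all PFA's $\mathcal{P}$. *)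

(* Defs.v *)
From HB Require Import structures.
From mathcomp Require Import all_boot all_order all_algebra.
From mathcomp Require Import classical_sets reals.

Set Implicit Arguments.
Unset Strict Implicit.
Unset Printing Implicit Defensive.

Import Order.TTheory GRing.Theory Num.Theory.
Local Open Scope classical_set_scope.
Local Open Scope ring_scope.

(* The tape alphabet: the input alphabet together with the two end-markers. *)
Inductive tape (Sigma : Type) : Type :=
  | LeftEnd
  | RightEnd
  | Sym of Sigma.
Arguments LeftEnd {Sigma}.
Arguments RightEnd {Sigma}.

(* Distributions are row vectors acted on from the right, so it is the rows
   that sum to 1. *)
Definition stochastic (R : realType) (n : nat) (A : 'M[R]_n) : Prop :=
  (forall i j, 0 <= A i j) /\ (forall i, \sum_j A i j = 1).

(* There are [pfa_pred_n.+1] states, since the start state [ord0] must exist. *)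
Record pfa (R : realType) (Sigma : finType) : Type := Pfa {
  pfa_pred_n : nat;
  pfa_trans : tape Sigma -> 'M[R]_pfa_pred_n.+1;
  pfa_final : {set 'I_pfa_pred_n.+1};
  pfa_transP : forall s, stochastic (pfa_trans s)
}.

Definition final_distr (R : realType) (Sigma : finType) (P : pfa R Sigma)
    (w : seq Sigma) : 'rV[R]_(pfa_pred_n P).+1 :=
  foldl (fun v s => v *m pfa_trans P s) (delta_mx 0 ord0)
        (LeftEnd :: rcons (map (@Sym Sigma) w) RightEnd).

Definition accept_prob (R : realType) (Sigma : finType) (P : pfa R Sigma)
    (w : seq Sigma) : R :=
  \sum_(i in pfa_final P) final_distr P w 0 i.

Definition language (Sigma : Type) : Type := set (seq Sigma).

Definition S_gt (R : realType) (Sigma : finType) : set (language Sigma) :=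
  [set L | exists (P : pfa R Sigma) (lambda : R),
     0 <= lambda < 1 /\ L = [set w | accept_prob P w > lambda]].

Definition S_eq (R : realType) (Sigma : finType) : set (language Sigma) :=
  [set L | exists (P : pfa R Sigma) (lambda : R),
     0 <= lambda <= 1 /\ L = [set w | accept_prob P w = lambda]].

Definition S_neq (R : realType) (Sigma : finType) : set (language Sigma) :=
  [set L | exists (P : pfa R Sigma) (lambda : R),
     0 <= lambda <= 1 /\ L = [set w | accept_prob P w <> lambda]].

Arguments S_gt R Sigma : clear implicits.
Arguments S_eq R Sigma : clear implicits.
Arguments S_neq R Sigma : clear implicits.

Definition lang_cat (Sigma : Type) (L1 L2 : language Sigma) : language Sigma :=
  [set u ++ v | u in L1 & v in L2].

Inductive ab : Type := La | Lb.

Definition bool_of_ab (x : ab) : bool := if x is La then true else false.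
Definition ab_of_bool (x : bool) : ab := if x then La else Lb.
Lemma bool_of_abK : cancel bool_of_ab ab_of_bool.
Proof. by case. Qed.

HB.instance Definition _ := Finite.copy ab (can_type bool_of_abK).

Definition L_eq : language ab := [set w | count_mem La w = count_mem Lb w].

Definition b_plus : language ab := [set w | exists2 k, (0 < k)%N & w = nseq k Lb].

Definition L_eqb : language ab := lang_cat L_eq b_plus.

(* Main.v *)
Require Import Defs.
From mathcomp Require Import all_boot all_order all_algebra.
From mathcomp Require Import classical_sets reals.
From mathcomp Require Import boolp ring lra zify.

(** Write [p], [q] for the numbers of [a]'s and [b]'s in [w], and [m] for the
    length of its longest suffix in [b^*].  Then [w] is in the language iff
    [p < q <= p + m], i.e. iff [(2E + 2m + 1)(2E + 1) < 0] for [E = p - q].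
    The monomials [1, E, E^2, m, Em] are updated linearly by each letter, so this
    is the positivity set of a matrix product; Turakainen's construction turns
    arbitrary real matrices into stochastic ones.

    Conversely, [f(a^d b^m) - lambda] has the form [x_d B^m y] and [a^d b^m] is
    in the language iff [d < m].  For large [d], Cayley-Hamilton shows that this
    sequence vanishes at [m = d] if it does for all [m > d], which excludes [S^=],
    and that it vanishes identically if it does for all [m <= d], which
    excludes [S^<>]. *)

Set Implicit Arguments.
Unset Strict Implicit.
Unset Printing Implicit Defensive.

Import Order.TTheory GRing.Theory Num.Theory.
Local Open Scope ring_scope.
Local Open Scope classical_set_scope.

Definition tape_word (Sigma : Type) (w : seq Sigma) : seq (tape Sigma) :=
  LeftEnd :: rcons (map (@Sym Sigma) w) RightEnd.

Lemma foldl_mulmx (R : realType) (T : Type) n (M : T -> 'M[R]_n.+1)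
    (v : 'rV[R]_n.+1) (l : seq T) :
  foldl (fun v s => v *m M s) v l = v *m \prod_(s <- l) M s.
Proof.
elim: l v => [|s l IH] v /=; first by rewrite big_nil mulmx1.
by rewrite IH big_cons -mulmxA.
Qed.

(** * Turakainen's construction *)

(** All cross terms vanish and [K] reproduces itself. The list is nonempty because an empty product
    would not contribute [K]. *)
Lemma prod_scale_add_idem (R : comNzRingType) (A : algType R) (T : Type)
    (K : A) (B : T -> A) (a : R) (s : T) (l : seq T) :
  K * K = K -> (forall t, B t * K = 0) -> (forall t, K * B t = 0) ->
  \prod_(t <- s :: l) (a *: B t + K) =
  a ^+ (size l).+1 *: \prod_(t <- s :: l) B t + K.
Proof.
move=> KK BK KB; elim: l s => [|t l IH] s; first by rewrite !big_seq1 expr1.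
rewrite big_cons IH (big_cons _ _ s) mulrDl !mulrDr KK -!scalerAl BK scaler0 addr0.
rewrite -(scalerAr _ K) [in K * _]big_cons mulrA KB mul0r scaler0 add0r.
by rewrite -scalerAr scalerA -exprS.
Qed.

(** The Kronecker product of [[1, -1], [-1, 1]] with [A]: its rows and columns sum to 0, and its
    upper left block is still [A]. The dimension is spelled as a successor to get a matrix ring. *)
Definition antidiag_double (R : realType) n (A : 'M[R]_n.+1)
    : 'M[R]_((n + n.+1).+1) :=
  block_mx A (- A) (- A) A : 'M_(n.+1 + n.+1).

Lemma antidiag_doubleM (R : realType) n (A B : 'M[R]_n.+1) :
  antidiag_double A * antidiag_double B = 2 *: antidiag_double (A * B).
Proof.
rewrite -!mulmxE /antidiag_double.
rewrite (@mulmx_block _ n.+1 n.+1 n.+1 n.+1 n.+1 n.+1).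
rewrite (@scale_block_mx _ n.+1 n.+1 n.+1 n.+1) !mulNmx !mulmxN !opprK.
by rewrite !scalerN !scaler_nat !mulr2n !opprD.
Qed.

Lemma prod_antidiag_double (R : realType) (T : Type) n (M : T -> 'M[R]_n.+1)
    (s : T) (l : seq T) :
  \prod_(t <- s :: l) antidiag_double (M t) =
  2 ^+ size l *: antidiag_double (\prod_(t <- s :: l) M t).
Proof.
elim: l s => [|t l IH] s; first by rewrite !big_seq1 scale1r.
by rewrite big_cons IH (big_cons _ _ s) -scalerAr antidiag_doubleM scalerA -exprSr.
Qed.

Lemma antidiag_double_const (R : realType) n (A : 'M[R]_n.+1) (c : R) :
  antidiag_double A * const_mx c = 0.
Proof.
rewrite /antidiag_double -mulmxE -[const_mx c](@block_mx_const _ n.+1 n.+1 n.+1 n.+1).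
rewrite (@mulmx_block _ n.+1 n.+1 n.+1 n.+1 n.+1 n.+1) !mulNmx subrr addNr.
exact: (@block_mx0 _ n.+1 n.+1 n.+1 n.+1).
Qed.

Lemma const_antidiag_double (R : realType) n (A : 'M[R]_n.+1) (c : R) :
  const_mx c * antidiag_double A = 0.
Proof.
rewrite /antidiag_double -mulmxE -[const_mx c](@block_mx_const _ n.+1 n.+1 n.+1 n.+1).
rewrite (@mulmx_block _ n.+1 n.+1 n.+1 n.+1 n.+1 n.+1) !mulmxN subrr addNr.
exact: (@block_mx0 _ n.+1 n.+1 n.+1 n.+1).
Qed.

Lemma tape_mx_bounded (R : realType) (Sigma : finType) n
    (B : tape Sigma -> 'M[R]_n) :
  exists2 c : R, 0 < c & forall s i j, `|B s i j| <= c.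
Proof.
pose N s := \sum_i \sum_j `|B s i j|.
have N0 s : 0 <= N s by do 2!(apply: sumr_ge0 => ? _).
have NS : 0 <= \sum_s N (Sym s) by apply: sumr_ge0.
have BN s i j : `|B s i j| <= N s.
  rewrite /N (bigD1 i) //= (bigD1 j) //= -addrA lerDl.
  by apply: addr_ge0; do ?(apply: sumr_ge0 => ? _).
exists (1 + N LeftEnd + N RightEnd + \sum_s N (Sym s)).
  have := N0 LeftEnd; have := N0 RightEnd; lra.
move=> s i j; apply: (le_trans (BN s i j)).
have := N0 LeftEnd; have := N0 RightEnd.
case: s => [||s]; [lra | lra |].
rewrite (bigD1 s) //= => *.
have : 0 <= \sum_(i | i != s) N (Sym i) by apply: sumr_ge0.
lra.
Qed.

(** Doubling makes all row sums 0; scaling down and adding the uniform matrix [K] then gives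
    stochastic matrices. On a word, the acceptance probability is [N%:R^-1] plus a positive multiple
    of the tested entry. *)
Lemma S_gt_prod_pos (R : realType) (Sigma : finType) n
    (M : tape Sigma -> 'M[R]_n.+1) (j : 'I_n.+1) :
  S_gt R Sigma
    [set w | 0 < (\prod_(s <- tape_word w) M s) ord0 j].
Proof.
pose N := (n + n.+1).+1.
pose B s := antidiag_double (M s).
have [c c0 Bc] := tape_mx_bounded B.
have N0 : 0 < N%:R :> R by rewrite ltr0n.
pose K : 'M[R]_N := const_mx N%:R^-1.
(* With [a * c] equal to the entries of [K], no entry of [a *: B s + K] is negative. *)
pose a : R := (c * N%:R)^-1.
have a0 : 0 < a by rewrite invr_gt0 mulr_gt0.
have BK s : B s * K = 0 by apply: antidiag_double_const.
have KB s : K * B s = 0 by apply: const_antidiag_double.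
have KK : K * K = K.
  apply/matrixP => i k; rewrite !mxE.
  rewrite (eq_bigr (fun=> N%:R^-1 * N%:R^-1)); last by move=> ? _; rewrite !mxE.
  by rewrite sumr_const card_ord -[LHS]mulr_natl mulVKf // gt_eqF.
have stA s : stochastic (a *: B s + K).
  split=> [i k|i].
    rewrite mxE [(a *: B s : matrix _ _ _) _ _]mxE [K _ _]mxE.
    have := Bc s i k; rewrite ler_norml => /andP[+ _] => Bik.
    have -> : N%:R^-1 = a * c by rewrite /a; field; rewrite !gt_eqF.
    by rewrite -mulrDr mulr_ge0 ?(ltW a0) //; lra.
  (* Multiplying by a constant matrix exposes the row sums: [B s] kills it and [K] preserves it. *)
  have : (a *: B s + K) *m (const_mx N%:R^-1 : 'M_N) = K.
    by rewrite mulmxDl -scalemxAl [B s *m _]BK scaler0 add0r; exact: KK.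
  move/matrixP/(_ i i); rewrite mxE [in RHS]mxE.
  under eq_bigr => k _ do rewrite [const_mx _ _ _]mxE.
  by rewrite -mulr_suml -[X in _ = X -> _]mul1r => /mulIf -> //; rewrite gt_eqF ?invr_gt0.
pose F : {set 'I_N} := [set lshift n.+1 j]%SET.
exists (@Pfa R Sigma (n + n.+1) _ F stA), N%:R^-1.
split.
  by rewrite invr_ge0 (ltW N0) invf_lt1 // ltr1n /N addnS.
apply/seteqP; suff E w : (N%:R^-1 < accept_prob (Pfa F stA) w)
   = (0 < (\prod_(s <- tape_word w) M s) ord0 j).
  by split=> w /=; rewrite E.
rewrite /accept_prob big_set1 /final_distr foldl_mulmx /=.
rewrite prod_scale_add_idem // prod_antidiag_double -/(tape_word w).
rewrite -rowE mxE.
have -> : (ord0 : 'I_N) = lshift n.+1 (ord0 : 'I_n.+1) by exact: val_inj.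
have entry (A : 'M[R]_n.+1) (i k : 'I_n.+1) :
    antidiag_double A (lshift n.+1 i) (lshift n.+1 k) = A i k.
  exact: (@block_mxEul _ n.+1 n.+1).
have affine (D : 'M[R]_N) x y i k :
    (x *: (y *: D) + K) i k = x * (y * D i k) + N%:R^-1 by rewrite !mxE.
rewrite affine entry.
by rewrite ltrDr !pmulr_rgt0 // exprn_gt0.
Qed.

(** * The language *)

(** The removed block of [b]'s must have length [k], the excess of [b]'s over [a]'s. So [k] must be
    positive and at most the length of the final run of [b]'s, which is [index La (rev w)], also
    when no [a] occurs. *)
Lemma L_eqbE (w : seq ab) :
  L_eqb w <->
  (count_mem La w < count_mem Lb w <= count_mem La w + index La (rev w))%N.
Proof.
split.
  move=> [u /= Lu [_ [k k0 ->] <-]].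
  rewrite !count_cat rev_cat rev_nseq index_cat !count_nseq /= Lu mem_nseq andbF size_nseq.
  by rewrite mul0n mul1n addn0 -addn1 !leq_add2l k0 leq_addr.
set k := (count_mem Lb w - count_mem La w)%N => /andP[ltpq leq_].
have kw : (k <= index La (rev w))%N by rewrite /k; lia.
have kwS : (k <= size w)%N by rewrite (leq_trans kw) // -(size_rev w) index_size.
have Ed : drop (size w - k) w = nseq k Lb.
  have /all_pred1P -> : all (pred1 Lb) (drop (size w - k) w).
    rewrite -all_rev -take_rev.
    apply/allP => x; case: x => // /index_ltn.
    by rewrite ltnNge kw.
  by rewrite size_drop subKn.
exists (take (size w - k) w); last first.
  by exists (nseq k Lb); [exists k => //; rewrite /k; lia | rewrite -Ed cat_take_drop].
rewrite /L_eq /=.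
have := cat_take_drop (size w - k) w; rewrite Ed => Ew.
have := congr1 (count_mem La) Ew; have := congr1 (count_mem Lb) Ew.
rewrite !count_cat !count_nseq /=.
rewrite mul0n mul1n addn0 => Eb Ea.
by apply: (@addIn k); rewrite Eb Ea /k subnKC // ltnW.
Qed.

Lemma L_eqb_anbm d m : L_eqb (nseq d La ++ nseq m Lb) <-> (d < m)%N.
Proof.
rewrite L_eqbE rev_cat !rev_nseq index_cat mem_nseq andbF.
rewrite !count_cat !count_nseq size_nseq /=.
split; lia.
Qed.

Definition monomials (R : realType) (x y : R) : 'rV[R]_5 :=
  \row_j nth 0 [:: 1; x; x ^+ 2; y; x * y] j.

(* Indexed by columns: column [j] expresses the new [j]-th monomial through the
   old ones.  [RightEnd] puts [- (2E + 2m + 1)(2E + 1)] in column 0. *)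
Definition monomial_step (R : realType) (s : tape ab) : 'M[R]_5 :=
  \matrix_(i, j) nth 0 (nth [::] match s with
    | LeftEnd => [:: [:: 1]]
    | RightEnd => [:: [:: - 1; - 4; - 4; - 2; - 4]]
    | Sym La => [:: [:: 1]; [:: 1; 1]; [:: 1; 2; 1]]
    | Sym Lb => [:: [:: 1]; [:: - 1; 1]; [:: 1; - 2; 1]; [:: 1; 0; 0; 1];
                    [:: - 1; 1; 0; - 1; 1]]
    end j) i.

Definition letter_excess (R : realType) (w : seq ab) : R :=
  (count_mem La w)%:R - (count_mem Lb w)%:R.

(** Missing columns of [monomial_step] are zero: [LeftEnd] thus starts at E = m = 0, and reading an
    [a] resets m and Em. *)
Lemma monomials_word (R : realType) (w : seq ab) :
  foldl (fun v s => v *m monomial_step R s) (delta_mx 0 ord0)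
    (LeftEnd :: map (@Sym ab) w) =
  monomials (letter_excess R w) (index La (rev w))%:R.
Proof.
elim/last_ind: w => [|w x IH].
  apply/rowP => -[[|[|[|[|[|//]]]]] ?];
    rewrite /= mxE !big_ord_recl big_ord0 !mxE /letter_excess /=; ring.
rewrite map_rcons -rcons_cons foldl_rcons IH /letter_excess.
rewrite -!cats1 !count_cat rev_cat /=.
apply/rowP => -[[|[|[|[|[|//]]]]] ?];
  rewrite mxE !big_ord_recl big_ord0 !mxE /=; case: x => /=;
  rewrite ?addn0 ?addn1 -?natr1; ring.
Qed.

Lemma L_eqb_S_gt (R : realType) : S_gt R ab L_eqb.
Proof.
suff -> : L_eqb = [set w | 0 <
    (\prod_(s <- tape_word w) monomial_step R s) ord0 ord0].
  exact: S_gt_prod_pos.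
apply/seteqP; suff E w : L_eqb w <->
    0 < (\prod_(s <- tape_word w) monomial_step R s) ord0 ord0.
  by split=> w /E.
set t := (X in 0 < X).
have -> : t = - ((2 * letter_excess R w + 2 * (index La (rev w))%:R + 1)
               * (2 * letter_excess R w + 1)).
  transitivity ((delta_mx 0 ord0 *m \prod_(s <- tape_word w) monomial_step R s)
                 (0 : 'I_1) ord0).
    by rewrite -rowE mxE.
  rewrite -foldl_mulmx /tape_word -rcons_cons foldl_rcons monomials_word.
  rewrite mxE !big_ord_recl big_ord0 !mxE /=; ring.
rewrite L_eqbE /letter_excess.
move: (count_mem La w) (count_mem Lb w) (index La (rev w)) => p q m.
(* Over the integers both factors are odd, hence nonzero. As m >= 0, the product is negative only if
   2E + 1 < 0 < 2E + 2m + 1, that is, E < 0 <= E + m. *)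
have -> : - ((2 * (p%:R - q%:R) + 2 * m%:R + 1) * (2 * (p%:R - q%:R) + 1)) =
  (- ((2 * (p%:Z - q%:Z) + 2 * m%:Z + 1) * (2 * (p%:Z - q%:Z) + 1)))%:~R :> R.
  ring.
rewrite ltr0z; split; nia.
Qed.

(** * Linear recurrences along powers of a matrix *)

Lemma horner_mx_sum (R : comNzRingType) n (B : 'M[R]_n.+1) (p : {poly R}) :
  horner_mx B p = \sum_(i < size p) p`_i *: B ^+ i.
Proof.
rewrite -{1}(coefK p) poly_def linear_sum /=.
by apply: eq_bigr => i _; rewrite linearZ /= rmorphXn /= horner_mx_X.
Qed.

(** Write the characteristic polynomial as X^r q with q(0) nonzero and q = q(0) + X s.
    Cayley-Hamilton gives q(0) B^r = - B^(r+1) s(B), and q(0) can be divided out even if [B] is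
    singular. *)
Lemma exp_mx_later (F : fieldType) n (B : 'M[F]_n.+1) :
  exists r (p : {poly F}), B ^+ r = B ^+ r.+1 * horner_mx B p.
Proof.
have [r [q + Eq]] := multiplicity_XsubC (char_poly B) 0.
rewrite monic_neq0 ?char_poly_monic //= => q0.
have [s Es] : exists s, q = q.[0]%:P + 'X * s.
  have : root (q - q.[0]%:P) 0 by rewrite /root !hornerE subrr.
  case/factor_theorem => s; rewrite subr0 => /eqP.
  by rewrite subr_eq => /eqP Es; exists s; rewrite {1}Es addrC mulrC.
exists r, (- q.[0]^-1 *: s).
have Ep : char_poly B = (q.[0] *: 'X^r + 'X^(r.+1) * s)%R.
  by rewrite Eq {1}Es subr0 -mul_polyC exprS; ring.
have := Cayley_Hamilton B.
rewrite Ep rmorphD rmorphM /= linearZ /= !rmorphXn /= horner_mx_X.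
move/eqP; rewrite addr_eq0 => /eqP E.
rewrite linearZ /= -scalerAr scaleNr -scalerN -E scalerA mulVf ?scale1r //.
Qed.

Section PowerSequence.
Variables (F : fieldType) (n : nat) (B : 'M[F]_n.+1).
Variables (x : 'rV[F]_n.+1) (y : 'cV[F]_n.+1).

Lemma mul_horner_mx_eq0 k (p : {poly F}) :
  (forall i, (i < size p)%N -> x *m B ^+ (k + i) *m y = 0) ->
  x *m (B ^+ k * horner_mx B p) *m y = 0.
Proof.
move=> xy0; rewrite horner_mx_sum mulr_sumr mulmx_sumr mulmx_suml big1 // => i _.
by rewrite -scalerAr -exprD -scalemxAr -scalemxAl xy0 ?scaler0.
Qed.

(** Modulo the characteristic polynomial, X^m has degree at most [n], so [B ^+ m] is a combination
    of the powers up to [n]. *)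
Lemma exp_mx_seq_eq0_init :
  (forall m, (m <= n)%N -> x *m B ^+ m *m y = 0) ->
  forall m, x *m B ^+ m *m y = 0.
Proof.
move=> xy0 m; pose p : {poly F} := 'X^m %% char_poly B.
have -> : B ^+ m = B ^+ 0 * horner_mx B p.
  rewrite expr0 mul1r -[in LHS](horner_mx_X B) -rmorphXn /=.
  rewrite [X in horner_mx _ X](divp_eq _ (char_poly B)).
  by rewrite rmorphD rmorphM /= Cayley_Hamilton mulr0 add0r.
apply: mul_horner_mx_eq0 => i ip; apply: xy0.
have : (size p < size (char_poly B))%N.
  by rewrite ltn_modp monic_neq0 ?char_poly_monic.
by rewrite size_char_poly !ltnS => ?; rewrite -ltnS (leq_trans ip).
Qed.

End PowerSequence.

(** The index [r] depends on [B] alone, so [x] may later be chosen in terms of [r]. *)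
Lemma exp_mx_seq_eq0_tail (F : fieldType) n (B : 'M[F]_n.+1) :
  exists r, forall (x : 'rV_n.+1) (y : 'cV_n.+1),
    (forall m, (r < m)%N -> x *m B ^+ m *m y = 0) -> x *m B ^+ r *m y = 0.
Proof.
have [r [p Ep]] := exp_mx_later B; exists r => x y xy0.
by rewrite Ep; apply: mul_horner_mx_eq0 => i _; apply: xy0; lia.
Qed.

(** * Excluding equality and inequality with a cutpoint *)

(** Stochastic matrices fix the all-ones column, so subtracting [lambda] amounts to subtracting
    [lambda *: one] from the indicator of the final states. Only [x] varies with [d]. *)
Lemma accept_prob_sub_anbm (R : realType) (P : pfa R ab) (lambda : R) :
  exists n (B : 'M[R]_n.+1) (x : nat -> 'rV_n.+1) (y : 'cV_n.+1),
  forall d m, accept_prob P (nseq d La ++ nseq m Lb) = lambda <->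
    x d *m B ^+ m *m y = 0.
Proof.
pose A := pfa_trans P.
pose one : 'cV[R]_((pfa_pred_n P).+1) := const_mx 1.
pose chi : 'cV[R]_((pfa_pred_n P).+1) := \col_i (i \in pfa_final P)%:R.
have A1 s : A s *m one = one.
  apply/colP => i; rewrite !mxE -[RHS](proj2 (pfa_transP P s) i).
  by apply: eq_bigr => j _; rewrite mxE mulr1.
have prod1 l : \prod_(s <- l) A s *m one = one.
  elim: l => [|s l IH]; first by rewrite big_nil mul1mx.
  by rewrite big_cons -mulmxA IH A1.
have fE w : final_distr P w *m (chi - lambda *: one)
            = (accept_prob P w - lambda)%:M.
  rewrite mulmxBr -scalemxAr {2}/final_distr foldl_mulmx -mulmxA prod1.
  rewrite raddfB /=; congr (_ - _).
    rewrite [LHS]mx11_scalar !mxE /accept_prob; congr (_%:M).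
    rewrite [RHS]big_mkcond /=; apply: eq_bigr => i _; rewrite mxE.
    by case: ifP => _; rewrite ?mulr1 ?mulr0.
  by rewrite -rowE [row _ _]mx11_scalar !mxE scale_scalar_mx mulr1.
exists (pfa_pred_n P), (A (Sym Lb)).
exists (fun d => delta_mx 0 ord0 *m (A LeftEnd * A (Sym La) ^+ d)).
exists (A RightEnd *m (chi - lambda *: one)) => d m.
set z := _ *m _ *m _.
have -> : z = (accept_prob P (nseq d La ++ nseq m Lb) - lambda)%:M.
  rewrite -fE /final_distr foldl_mulmx big_cons -cats1 big_cat big_seq1.
  rewrite big_map big_cat !big_nseq -!Monoid.iteropE /=.
  by rewrite /z -!mulmxE !mulmxA.
split=> [-> |/matrixP/(_ 0 0)]; first by rewrite subrr raddf0.
by rewrite !mxE /= mulr1n => /eqP; rewrite subr_eq0 => /eqP.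
Qed.

Theorem theorem4p3 (R : realType) :
  (S_gt R ab `\` (S_eq R ab `|` S_neq R ab)) L_eqb.
Proof.
split; first exact: L_eqb_S_gt.
case=> -[P [lambda [_ EL]]].
- have inL d m : accept_prob P (nseq d La ++ nseq m Lb) = lambda <-> (d < m)%N.
    by rewrite -L_eqb_anbm EL.
  have [n [B [x [y E]]]] := accept_prob_sub_anbm P lambda.
  (* Take d = r: the sequence vanishes for all m > r, hence at m = r, which would put a^r b^r in the
     language. *)
  have [r /(_ (x r) y) tail] := exp_mx_seq_eq0_tail B.
  suff : (r < r)%N by rewrite ltnn.
  by apply/inL/E/tail => m /inL/E.
- have inL d m : accept_prob P (nseq d La ++ nseq m Lb) <> lambda <-> (d < m)%N.
    by rewrite -L_eqb_anbm EL.
  have [n [B [x [y E]]]] := accept_prob_sub_anbm P lambda.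
  (* Take d = n: the words a^n b^m with m <= n lie outside the language, which gives [n.+1] initial
     zeros and hence a zero at m = n + 1, where the word is inside. *)
  have /inL : (n < n.+1)%N by [].
  apply; apply/E/exp_mx_seq_eq0_init => m le_mn; apply/E.
  apply: contrapT => /inL; lia.
Qed.
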